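(* Let $\mathcal{g} = T_0^{l_0} + T_1^{l_1} + T_2^{l_2}$ be a trinomial with $n_il_{i1}>1$ for all $i=0,1,2$ (i.e. no monomial of $\mathcal{g}$ is linear), and let $R(\mathcal{g}) = \mathbb{K}[T_{ij}]/(\mathcal{g})$ be equipped with the $K$-grading $\deg$. The algebra $R(\mathcal{g})$ admits a nonzero $\deg$-homogeneous locally nilpotent derivation if and only if $l_{ij}=1$ for some $i\in\{0,1,2\}$ and $j\in\{1,\ldots,n_i\}$.
   Context: $\mathbb{K}$ is an algebraically closed field of characteristic zero. A derivation of a $\mathbb{K}$-algebra $R$ is a $\mathbb{K}$-linear map $\delta\colon R\to R$ with $\delta(fg)=\delta(f)g+f\delta(g)$; it is locally nilpotent if for every $f\in R$ there is a positive integer $m$ with $\delta^m(f)=0$. Trinomial algebras. Fix positive integers $n_0,n_1,n_2$, let $n=n_0+n_1+n_2$, and for each $i=0,1,2$ fix a tuple $l_i=(l_{i1},\ldots,l_{in_i})$ of positive integers. In the polynomial algebra $\mathbb{K}[T_{ij}]$ in the $n$ variables $T_{ij}$, $i=0,1,2$, $j=1,\ldots,n_i$, put $T_i^{l_i}=T_{i1}^{l_{i1}}\cdots T_{in_i}^{l_{in_i}}$. A trinomial is a polynomial $\mathcal{g}=T_0^{l_0}+T_1^{l_1}+T_2^{l_2}$ of this form; it is irreducible, and the domain $R(\mathcal{g})=\mathbb{K}[T_{ij}]/(\mathcal{g})$ is called a trinomial algebra. The grading $\deg$. Let $L=\begin{pmatrix}-l_0&l_1&0\\-l_0&0&l_2\end{pmatrix}$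 (a $2\times n$ integer matrix), $L^*$ its transpose, $K=\mathbb{Z}^n/\operatorname{Im}L^*$, and $Q\colon\mathbb{Z}^n\to K$ the projection. With $e_{ij}$ the canonical basis vectors of $\mathbb{Z}^n$, setting $\deg T_{ij}=Q(e_{ij})$ defines a $K$-grading on $\mathbb{K}[T_{ij}]$ for which $\mathcal{g}$ is homogeneous, hence a $K$-grading on $R(\mathcal{g})$, denoted $\deg$. A derivation of a graded algebra $R=\bigoplus_{w\in K}R_w$ is homogeneous if it maps homogeneous elements to homogeneous elements (in which case there is $d\in K$ with $\delta(R_w)\subseteq R_{w+d}$ for all $w\in K$). *)

(* Defs.v *)
From HB Require Import structures.
From mathcomp Require Import all_boot all_order all_algebra.
From mathcomp Require Import mpoly.
From mathcomp Require Import boolp.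

Set Implicit Arguments.
Unset Strict Implicit.
Unset Printing Implicit Defensive.

Import GRing.Theory.
Local Open Scope ring_scope.
Local Open Scope quotient_scope.

(** The library makes the quotient of a commutative ring by a proper ideal a
    commutative ring; when the ring is an algebra over [K], so is the quotient. *)
Section QuotientAlgebra.
Variables (K : nzRingType) (A : comAlgType K) (I : idealr A).

Definition quot_scale (a : K) (x : {ideal_quot I}) : {ideal_quot I} :=
  \pi_({ideal_quot I}) (a *: repr x).

Lemma pi_scale (a : K) (p : A) :
  quot_scale a (\pi_({ideal_quot I}) p) =
    \pi_({ideal_quot I}) (a *: p).
Proof.
rewrite /quot_scale; apply/eqP; rewrite -Quotient.idealrBE -scalerBr.
by rewrite -mulr_algl idealMr // Quotient.idealrBE reprK.
Qed.

Lemma quot_scaleA a b x : quot_scale a (quot_scale b x) = quot_scale (a * b) x.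
Proof. by elim/quotW: x => x; rewrite (pi_scale b) !pi_scale scalerA. Qed.

Lemma quot_scale1 : left_id 1 quot_scale.
Proof. by elim/quotW=> x; rewrite pi_scale scale1r. Qed.

Lemma quot_scaleDr : right_distributive quot_scale +%R.
Proof.
move=> a; elim/quotW=> x; elim/quotW=> y.
by rewrite -rmorphD !pi_scale scalerDr rmorphD.
Qed.

Lemma quot_scaleDl x : {morph quot_scale^~ x : a b / a + b}.
Proof. by elim/quotW: x => x a b; rewrite !pi_scale scalerDl rmorphD. Qed.

HB.instance Definition _ := GRing.Zmodule_isLmodule.Build K {ideal_quot I}
  quot_scaleA quot_scale1 quot_scaleDr quot_scaleDl.

Lemma pi_scaleE (a : K) (p : A) :
  \pi_({ideal_quot I}) (a *: p) = a *: \pi_({ideal_quot I}) p.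
Proof. by rewrite -pi_scale. Qed.

Lemma quot_scaleAl (a : K) (x y : {ideal_quot I}) :
  a *: (x * y) = (a *: x) * y.
Proof.
elim/quotW: x => x; elim/quotW: y => y.
by rewrite -pi_scaleE -!rmorphM /= -pi_scaleE scalerAl.
Qed.

HB.instance Definition _ :=
  GRing.Lmodule_isLalgebra.Build K {ideal_quot I} quot_scaleAl.

Lemma quot_scaleAr (a : K) (x y : {ideal_quot I}) :
  a *: (x * y) = x * (a *: y).
Proof. by rewrite mulrC quot_scaleAl mulrC. Qed.

HB.instance Definition _ :=
  GRing.Lalgebra_isAlgebra.Build K {ideal_quot I} quot_scaleAr.

End QuotientAlgebra.

Section Derivations.
Variables (K : nzRingType) (A : algType K).

Definition derivation (d : {linear A -> A}) :=
  forall f g, d (f * g) = d f * g + f * d g.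

Definition locally_nilpotent (d : {linear A -> A}) :=
  forall f, exists2 m, (0 < m)%N & iter m d f = 0.

End Derivations.

Record trinomial := Trinomial {
  nvars : 'I_3 -> nat;
  expo : forall i, 'I_(nvars i) -> nat;
  nvars_gt0 : forall i, (0 < nvars i)%N;
  expo_gt0 : forall i j, (0 < @expo i j)%N
}.

Arguments expo : clear implicits.

Section Trinomial.
Variable t : trinomial.
Local Notation n := (\sum_i nvars t i)%N.

Definition idx1 i : 'I_(nvars t i) := Ordinal (nvars_gt0 t i).

(** [n_i * l_i1 <= 1] happens exactly when the [i]-th monomial is a single
    variable with exponent 1. *)
Definition nonlinear := forall i, (1 < nvars t i * expo t i (idx1 i))%N.

(** Row [k] of [Lmx] has [- l_0] in block 0 and [l_(k+1)] in block [k+1];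
    [tagnat] turns an index below [n] into a pair [(i, j)] and back. *)
Definition Lmx : 'M[int]_(2, n) :=
  \matrix_(k, s)
    let i := tagnat.sig1 s in let l := (expo t i (tagnat.sig2 s))%:Z in
    if i == ord0 then - l else if i == lift ord0 k then l else 0.

(** Membership is made boolean by [asbool], as the quotient construction
    requires; likewise for [trinomial_ideal] below. *)
Definition imLT : {pred 'cV[int]_n} :=
  fun v => `[< exists u : 'cV[int]_2, v = Lmx^T *m u >].

Lemma imLT_zmod : zmod_closed imLT.
Proof.
split; first by apply/asboolP; exists 0; rewrite mulmx0.
move=> _ _ /asboolP[u ->] /asboolP[v ->]; apply/asboolP.
by exists (u - v); rewrite mulmxBr.
Qed.

HB.instance Definition _ := GRing.isZmodClosed.Build _ imLT imLT_zmod.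

Definition grading_group := {ideal_quot imLT}.

HB.instance Definition _ := GRing.Zmodule.on grading_group.

Definition degv (s : 'I_n) : grading_group :=
  \pi_({ideal_quot imLT}) (delta_mx s 0).

Definition degm (m : 'X_{1..n}) : grading_group := \sum_s degv s *+ m s.

Section Algebra.
Variable K : fieldType.

Definition Tvar i (j : 'I_(nvars t i)) : {mpoly K[n]} := 'X_(tagnat.Rank i j).

Definition trinomial_poly : {mpoly K[n]} :=
  \sum_i \prod_j Tvar j ^+ expo t i j.

Definition trinomial_ideal : {pred {mpoly K[n]}} :=
  fun p => `[< exists q, p = q * trinomial_poly >].

Lemma trinomial_poly_at0 : trinomial_poly.@[fun=> 0] = 0.
Proof.
rewrite /trinomial_poly rmorph_sum big1 // => i _.
rewrite rmorph_prod (bigD1 (idx1 i)) //= rmorphXn /= mevalXU.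
by rewrite expr0n gtn_eqF ?expo_gt0 // mul0r.
Qed.

Lemma trinomial_idealP : idealr_closed trinomial_ideal.
Proof.
split; first by apply/asboolP; exists 0; rewrite mul0r.
  apply/asboolP => -[q /(congr1 (meval (fun=> 0)))] /eqP.
  by rewrite rmorph1 rmorphM /= trinomial_poly_at0 mulr0 oner_eq0.
move=> a _ _ /asboolP[u ->] /asboolP[v ->]; apply/asboolP.
by exists (a * u + v); rewrite mulrDl mulrA.
Qed.

HB.instance Definition _ := isIdealr.Build _ trinomial_ideal trinomial_idealP.

Definition trinomial_algebra := {ideal_quot trinomial_ideal}.

HB.instance Definition _ := GRing.ComAlgebra.on trinomial_algebra.

(** The degree-[w] parts of [K[T]] and, as its image, of the quotient; both
    contain 0, so 0 is homogeneous (of every degree). *)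
Definition poly_component (w : grading_group) (p : {mpoly K[n]}) :=
  {in msupp p, forall m, degm m = w}.

Definition component (w : grading_group) (f : trinomial_algebra) :=
  exists2 p, poly_component w p & f = \pi_({ideal_quot trinomial_ideal}) p.

Definition homogeneous (f : trinomial_algebra) := exists w, component w f.

Definition deg_homogeneous (d : {linear trinomial_algebra -> trinomial_algebra})
  := forall f, homogeneous f -> homogeneous (d f).

End Algebra.
End Trinomial.

(* Main.v *)
From HB Require Import structures.
Require Import Defs.
From mathcomp Require Import all_boot all_order all_algebra.
From mathcomp Require Import mpoly boolp zify ring.

(** Write [y_i] for the [i]-th monomial of the trinomial [g], so that
    [y_0 + y_1 + y_2 = 0] in the quotient.

    Suppose that a variable [x] has exponent one, say [y_i = x * M], and let [z]
    be a variable of another monomial [y_k].  The derivation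
    [M * d/dz - (d y_k / dz) * d/dx] kills [g], because both of its terms take
    [g] to [M * (d y_k / dz)].  It is triangular ([z] goes to [M], which is in
    the kernel, [x] goes to a polynomial that does not involve [x], and the other
    variables go to 0), hence locally nilpotent, and it shifts degrees by a
    constant.  It is nonzero because monomials have nonzero classes
    ([res_X_neq0]).

    Conversely, suppose that all exponents are at least two and let [d] be a
    homogeneous locally nilpotent derivation.  For [f != 0] let [nu f] be the
    largest [k] such that the [k]-th iterate of [d] does not vanish at [f].
    In characteristic zero [nu] is additive on products of homogeneous elements
    ([nuM]), by Leibniz' formula and because these are not zero divisors
    ([homogeneous_mulf_eq0]).
    Since the [y_i] add up to zero, the largest value [N] of the [nu y_i] is
    reached for two monomials [y_p] and [y_q] ([max_nu_sum0]).  If [N > 0], there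
    are variables [x] of [y_p] and [z] of [y_q] with [nu x > 0] and [nu z > 0],
    and [2 * nu x <= N], [2 * nu z <= N] since the exponents are at least two.
    Now [x] does not divide [d x], as [nu (d x) = nu x - 1].  The degrees of
    [d x] and [d z] differ by [deg x - deg z] ([component_deriv_X]), and monomials
    of equal degree differ, inside each block of variables, by a multiple of the
    block monomial.  A monomial of [d x] without [x] therefore forces [y_p / x] to
    divide every monomial of [d z] ([block_mon_cofactor_le]).  So
    [nu z - 1 = nu (d z) >= N - nu x], that is [nu x + nu z > N], which
    contradicts the two bounds above.  Hence [N = 0], so [d] kills every variable
    ([no_derivation]).

    Homogeneous elements are not zero divisors for the following reason.  Fix a
    variable [x] of a block [i].  The monomials of a homogeneous polynomial differ
    in block [i] by powers of [y_i], which can be replaced by the opposite of the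
    sum of the other two monomials: every homogeneous element is the class of a
    monomial of block [i] times a polynomial free of [x]
    ([component_normal_form]).  A product of two such classes has the same shape,
    and such a class vanishes only if its second factor does
    ([block_monomial_res_neq0]), because a nonzero multiple of [g] involves [x]. *)

Set Implicit Arguments.
Unset Strict Implicit.
Unset Printing Implicit Defensive.

Import GRing.Theory.
Local Open Scope ring_scope.
Local Open Scope quotient_scope.

(** * Derivations and nilpotency *)

Section Derivation.
Variables (K : nzRingType) (A : algType K) (d : {linear A -> A}).
Hypothesis der : derivation d.

Lemma derivation1 : d 1 = 0.
Proof.
have /eqP := der 1 1.
by rewrite !mulr1 mul1r -subr_eq0 opprD addNKr oppr_eq0 => /eqP.
Qed.

Lemma derivation_iterM n f g :
  iter n d (f * g) =
    \sum_(i < n.+1) (iter (n - i) d f * iter i d g) *+ 'C(n, i).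
Proof.
elim: n => [|n IHn]; first by rewrite big_ord1 bin0.
rewrite iterS IHn linear_sum /=.
under eq_bigr => i _ do rewrite raddfMn /= der mulrnDl -!iterS.
rewrite big_split /= big_ord_recl [in RHS]big_ord_recl /= !subn0 !bin0 -addrA.
congr (_ + _).
under [in RHS]eq_bigr => i _ do
  rewrite /bump leq0n add1n /= binS subSS mulrnDr.
rewrite big_split /=; congr (_ + _).
rewrite [in RHS]big_ord_recr /= bin_small // mulr0n addr0.
by apply: eq_bigr => i _; rewrite /bump leq0n add1n -iterS subnSK.
Qed.

End Derivation.

Section Order.
Variables (K : nzRingType) (A : algType K) (d : {linear A -> A}).
Hypothesis lnd : locally_nilpotent d.

Lemma iter0 k : iter k d 0 = 0.
Proof. by elim: k => //= k ->; rewrite linear0. Qed.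

Lemma iter_sum k (I : finType) (y : I -> A) :
  iter k d (\sum_i y i) = \sum_i iter k d (y i).
Proof. by elim: k => //= k ->; rewrite linear_sum. Qed.

Lemma iter_eq0_ge k l f : (k <= l)%N -> iter k d f = 0 -> iter l d f = 0.
Proof. by move=> /subnK <- kf; rewrite iterD kf iter0. Qed.

Fact nilpotency f : exists k, iter k d f == 0.
Proof. by have [k _ kf] := lnd f; exists k; apply/eqP. Qed.

(** The degree function of [d].  The least exponent that kills [f] exceeds it by
    one when [f != 0]; the predecessor gives [0] the value 0. *)
Definition nu f := (ex_minn (nilpotency f)).-1.

Lemma iter_gt_nu k f : (nu f < k)%N -> iter k d f = 0.
Proof.
rewrite /nu; case: ex_minnP => m /eqP m0 _ ltmk.
by apply: iter_eq0_ge m0; lia.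
Qed.

Lemma iter_nu f : f != 0 -> iter (nu f) d f != 0.
Proof.
rewrite /nu; case: ex_minnP => -[|m] /= m0 min f0; first by rewrite m0 in f0.
by apply/negP => /min; rewrite ltnn.
Qed.

Lemma nu_eq k f : iter k d f != 0 -> iter k.+1 d f = 0 -> nu f = k.
Proof.
move=> k0 k1; apply/eqP; rewrite eqn_leq; apply/andP; split; last first.
  by rewrite leqNgt; apply: contra k0 => /iter_gt_nu ->.
rewrite leqNgt; apply/negP => ltk.
have f0 : f != 0 by apply: contraNneq k0 => ->; rewrite iter0.
by have := iter_nu f0; rewrite (iter_eq0_ge ltk k1) eqxx.
Qed.

Lemma nu_deriv f : d f != 0 -> nu f = (nu (d f)).+1.
Proof.
by move=> df0; apply: nu_eq; rewrite iterSr; [apply: iter_nu | apply: iter_gt_nu].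
Qed.

Lemma nu_eq0 f : nu f = 0%N -> d f = 0.
Proof. by move=> f0; apply: (@iter_gt_nu 1); rewrite f0. Qed.

(** A single term of largest order could not be cancelled by the others. *)
Lemma max_nu_sum0 (I : finType) (i0 : I) (y : I -> A) :
  (forall i, y i != 0) -> \sum_i y i = 0 ->
  exists p q, [/\ p != q, nu (y p) = nu (y q) &
    forall i, (nu (y i) <= nu (y p))%N].
Proof.
move=> y0 sum0; pose p := [arg max_(i > i0) nu (y i)].
have maxp i : (nu (y i) <= nu (y p))%N.
  by rewrite /p; case: arg_maxnP => // j _; apply.
have [/existsP[q /andP[ne /eqP eq]]|none] :=
  boolP [exists q, (p != q) && (nu (y p) == nu (y q))].
  by exists p, q.
have := iter_sum (nu (y p)) y; rewrite sum0 iter0 (bigD1 p) //=.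
rewrite big1 => [/esym/eqP|i ne].
  by rewrite addr0 (negPf (iter_nu (y0 p))).
apply: iter_gt_nu; rewrite ltn_neqAle maxp andbT.
move: none; rewrite negb_exists => /forallP/(_ i).
by rewrite negb_and negbK eq_sym (negPf ne) /= eq_sym.
Qed.

End Order.

Section Nilpotent.
Variables (K : nzRingType) (A : algType K) (d : {linear A -> A}).
Hypothesis der : derivation d.

Definition nilpotent_at f := exists k, iter k d f = 0.

Lemma nilpotent_atD f h : nilpotent_at f -> nilpotent_at h -> nilpotent_at (f + h).
Proof.
move=> [a fa] [b hb]; exists (a + b)%N.
have iterA k : iter k d (f + h) = iter k d f + iter k d h.
  by elim: k => //= k ->; rewrite linearD.
by rewrite iterA (iter_eq0_ge _ fa) ?(iter_eq0_ge _ hb) ?addr0 ?leq_addr ?leq_addl.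
Qed.

Lemma nilpotent_atZ c f : nilpotent_at f -> nilpotent_at (c *: f).
Proof.
move=> [a fa]; exists a; have -> : iter a d (c *: f) = c *: iter a d f.
  by elim: (a) => //= k ->; rewrite linearZ.
by rewrite fa scaler0.
Qed.

Lemma nilpotent_atM f h : nilpotent_at f -> nilpotent_at h -> nilpotent_at (f * h).
Proof.
move=> [a fa] [b hb]; exists (a + b)%N; rewrite derivation_iterM //.
apply: big1 => i _; have [le|lt] := leqP b i.
  by rewrite (iter_eq0_ge le hb) mulr0 mul0rn.
by rewrite (iter_eq0_ge (_ : a <= a + b - i)%N fa) ?mul0r ?mul0rn //; lia.
Qed.

Lemma nilpotent_at1 : nilpotent_at 1.
Proof. by exists 1%N; rewrite /= derivation1. Qed.

Lemma nilpotent_atXn f k : nilpotent_at f -> nilpotent_at (f ^+ k).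
Proof.
move=> nf; elim: k => [|k IHk]; first exact: nilpotent_at1.
by rewrite exprS; apply: nilpotent_atM.
Qed.

Lemma nilpotent_at_deriv f : nilpotent_at (d f) -> nilpotent_at f.
Proof. by move=> [k kf]; exists k.+1; rewrite iterSr. Qed.

End Nilpotent.

(** * Monomials and their degrees *)

Lemma col_natE n (m : 'I_n -> nat) :
  \col_s (m s)%:Z = \sum_s delta_mx s 0 *+ m s.
Proof.
apply/colP => s; rewrite mxE summxE (bigD1 s) //= big1 => [|s' ne_s's].
  by rewrite mulmxnE !mxE !eqxx addr0 -[LHS]natz.
by rewrite mulmxnE !mxE eq_sym (negPf ne_s's) mul0rn.
Qed.

Lemma sum_mnm1 n (V : nmodType) (F : 'I_n -> V) s :
  \sum_s' F s' *+ U_(s)%MM s' = F s.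
Proof.
rewrite (bigD1 s) //= mnm1E eqxx big1 ?addr0 // => s' ne_s's.
by rewrite mnm1E eq_sym (negPf ne_s's).
Qed.

Section Combinatorics.
Variable t : trinomial.
Local Notation n := (\sum_i nvars t i)%N.

(** An index [s] below [n] stands for the variable [T_ij] with [i] its block;
    flat indices avoid dependent pairs in everything that follows. *)
Definition block (s : 'I_n) : 'I_3 := tagnat.sig1 s.
Definition weight (s : 'I_n) : nat := expo t (block s) (tagnat.sig2 s).
Definition block_mon (i : 'I_3) : 'X_{1..n} :=
  [multinom (if block s == i then weight s else 0%N) | s < n].

Lemma block_Rank i (j : 'I_(nvars t i)) : block (tagnat.Rank i j) = i.
Proof. exact: tagnat.Rank1K. Qed.

Lemma weight_Rank i (j : 'I_(nvars t i)) :
  weight (tagnat.Rank i j) = expo t i j.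
Proof.
rewrite /weight /block /tagnat.sig1 /tagnat.sig2 /tagnat.Rank.
by rewrite tagnat.rankK.
Qed.

Lemma weight_gt0 s : (0 < weight s)%N.
Proof. exact: expo_gt0. Qed.

Lemma block_onto i : exists s, block s = i.
Proof. by exists (tagnat.Rank i (idx1 t i)); rewrite block_Rank. Qed.

Lemma trinomial_polyE (K : fieldType) :
  trinomial_poly t K = \sum_i 'X_[block_mon i].
Proof.
apply: eq_bigr => i _; rewrite mpolyXE_id.
rewrite (reindex _ (onW_bij _ (@tagnat.rank_bij _ (nvars t)))) /=.
transitivity (\prod_(i' < 3) \prod_(j < nvars t i')
   'X_(tagnat.Rank i' j) ^+ block_mon i (tagnat.Rank i' j) : {mpoly K[n]});
  last first.
  by rewrite sig_big_dep /=; apply: eq_bigr => -[].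
rewrite [RHS](bigD1 i) //= [X in _ * X]big1 ?mulr1 => [|i' ne_i'i].
  by apply: eq_bigr => j _; rewrite mnmE block_Rank eqxx weight_Rank.
by apply: big1 => j _; rewrite mnmE block_Rank (negPf ne_i'i) expr0.
Qed.

Lemma degmE (m : 'X_{1..n}) :
  degm m = \pi_(grading_group t) (\col_s (m s)%:Z).
Proof.
by rewrite col_natE raddf_sum; apply: eq_bigr => s _; rewrite raddfMn.
Qed.

Lemma degmD m1 m2 : degm (m1 + m2)%MM = degm m1 + degm m2 :> grading_group t.
Proof. by rewrite -big_split; apply: eq_bigr => s _; rewrite mnmDE mulrnDr. Qed.

Lemma degm1 s : degm U_(s)%MM = degv s :> grading_group t.
Proof. exact: sum_mnm1. Qed.

(** The rows of the matrix are the differences of the block monomials 1 and 2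
    with the block monomial 0, so their span consists of the combinations of the
    three block monomials with coefficients of sum 0. *)
Lemma eq_degm (m1 m2 : 'X_{1..n}) : degm m1 = degm m2 :> grading_group t <->
  exists2 c : 'I_3 -> int, \sum_i c i = 0 &
    forall s, (m1 s)%:Z - (m2 s)%:Z = c (block s) * (weight s)%:Z.
Proof.
have LE (u : 'cV[int]_2) s : ((Lmx t)^T *m u) s 0 =
    (if block s == ord0 then - (u 0 0 + u 1 0)
     else if block s == lift ord0 0 then u 0 0 else u 1 0) * (weight s)%:Z.
  rewrite mxE big_ord_recl big_ord1 !mxE /= -/(block s) -/(weight s).
  have -> : lift ord0 ord0 = 1 :> 'I_2 by apply: val_inj.
  have [_|ne0] := boolP (block s == ord0); first by ring.
  have [->|ne1] := eqVneq (block s) (lift ord0 0).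
    by rewrite -val_eqE /=; ring.
  have -> : block s == lift ord0 1.
    by move: (block s) ne0 ne1 => [[|[|[|]]] ?].
  by ring.
rewrite !degmE; split=> [/eqP|[c c0 cE]].
  rewrite -Quotient.idealrBE => /asboolP[u uE].
  exists (fun i => if i == ord0 then - (u 0 0 + u 1 0)
     else if i == lift ord0 0 then u 0 0 else u 1 0) => [|s].
    by rewrite !big_ord_recl big_ord0 /=; ring.
  by rewrite -LE -uE !mxE.
apply/eqP; rewrite -Quotient.idealrBE; apply/asboolP.
exists (\col_k c (lift ord0 k)); apply/matrixP => s k.
rewrite (ord1 k) LE !mxE cE; congr (_ * _).
move: c0; rewrite !big_ord_recl big_ord0 addr0.
have -> : lift ord0 ord0 = 1 :> 'I_2 by apply: val_inj.
have [-> /eqP|ne0 _] := eqVneq (block s) ord0.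
  by rewrite addr_eq0 => /eqP ->.
have [-> //|ne1] := eqVneq (block s) (lift ord0 0).
congr c; apply: val_inj; move: (block s) ne0 ne1.
by move=> [[|[|[|]]] ?].
Qed.

End Combinatorics.

(** * Polynomials that do not involve a given variable *)

Section FreeOfVariable.
Variables (K : fieldType) (n : nat) (s : 'I_n).
Implicit Types p q : {mpoly K[n]}.

(** [p] seen as a polynomial in the single variable ['X_s].  The coefficients are
    kept in the full polynomial ring, which makes being free of ['X_s] an
    equation between [univariate p] and the constant [p]. *)
Definition univariate p : {poly {mpoly K[n]}} :=
  mmap (polyC \o @mpolyC n K) (fun s' => if s' == s then 'X else ('X_s')%:P) p.

Fact univariate_zmod : zmod_morphism univariate. Proof. exact: raddfB. Qed.
Fact univariate_monoid : monoid_morphism univariate.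
Proof. by split; [exact: rmorph1 | exact: rmorphM]. Qed.
HB.instance Definition _ :=
  GRing.isZmodMorphism.Build _ _ univariate univariate_zmod.
HB.instance Definition _ :=
  GRing.isMonoidMorphism.Build _ _ univariate univariate_monoid.

Definition free_of p := univariate p = p%:P.

Lemma univariate_Xs : univariate 'X_s = 'X.
Proof. by rewrite /univariate mmapX mmap1U eqxx. Qed.

Lemma free_ofX (m : 'X_{1..n}) : m s = 0%N -> free_of 'X_[m].
Proof.
move=> ms0; rewrite /free_of /univariate mmapX /mmap1 mpolyXE_id rmorph_prod /=.
apply: eq_bigr => s' _; rewrite rmorphXn /=.
by case: eqP => // ->; rewrite ms0.
Qed.

Lemma free_ofM p q : free_of p -> free_of q -> free_of (p * q).
Proof. by rewrite /free_of !rmorphM /= => -> ->. Qed.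

Lemma free_ofXn p k : free_of p -> free_of (p ^+ k).
Proof. by rewrite /free_of !rmorphXn /= => ->. Qed.

Lemma free_ofN p : free_of p -> free_of (- p).
Proof. by rewrite /free_of !rmorphN /= => ->. Qed.

Lemma free_ofZ c p : free_of p -> free_of (c *: p).
Proof.
by rewrite -mul_mpolyC; apply: free_ofM; rewrite /free_of /univariate mmapC.
Qed.

Lemma free_of_sum (I : eqType) (r : seq I) (P : pred I) (F : I -> {mpoly K[n]}) :
  {in r, forall i, P i -> free_of (F i)} -> free_of (\sum_(i <- r | P i) F i).
Proof.
rewrite /free_of !rmorph_sum /= => fF.
rewrite big_seq_cond [RHS]big_seq_cond.
by apply: eq_bigr => i /andP[/fF/[apply]].
Qed.

(** Nonzero multiples of ['X_s ^+ l * a + b] have degree at least [l] in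
    ['X_s]. *)
Lemma free_of_multiple p q a b l : (0 < l)%N -> a != 0 ->
  free_of a -> free_of b -> free_of p -> p = q * ('X_s ^+ l * a + b) -> p = 0.
Proof.
move=> l0 a0 fa fb fp /(congr1 univariate).
rewrite fp rmorphM rmorphD rmorphM rmorphXn /=.
rewrite univariate_Xs fa fb => pE; apply/eqP; apply: contraT => p0.
have szg : size ('X^l * a%:P + b%:P) = l.+1.
  have sza : size ('X^l * a%:P) = l.+1.
    by rewrite mulrC size_mulXn ?polyC_eq0 // size_polyC a0 addn1.
  by rewrite size_polyDl sza // ltnS (leq_trans (size_polyC_leq1 _)).
have q0 : univariate q != 0.
  by apply: contraNneq p0 => q0; rewrite -polyC_eq0 pE q0 mul0r.
have := congr1 (size : {poly _} -> nat) pE.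
rewrite size_polyC p0 size_mul // -?size_poly_eq0 szg //.
move: q0; rewrite -size_poly_gt0 addnS /=.
by case: (size (univariate q)) => // k _; lia.
Qed.

End FreeOfVariable.

(** * The quotient by the trinomial *)

Section Quotient.
Variables (t : trinomial) (K : fieldType).
Local Notation n := (\sum_i nvars t i)%N.
Local Notation R := (trinomial_algebra t K).
Local Notation g := (trinomial_poly t K).

Definition residue (p : {mpoly K[n]}) : R :=
  \pi_({ideal_quot (@trinomial_ideal t K)}) p.
Local Notation res := residue.

Fact res_zmod : zmod_morphism res. Proof. exact: raddfB. Qed.
HB.instance Definition _ := GRing.isZmodMorphism.Build _ _ res res_zmod.
Fact res_mul : monoid_morphism res.
Proof. by split; [exact: rmorph1 | exact: rmorphM]. Qed.
HB.instance Definition _ := GRing.isMonoidMorphism.Build _ _ res res_mul.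
Fact res_scale : scalable res. Proof. exact: pi_scaleE. Qed.
HB.instance Definition _ := GRing.isScalable.Build _ _ _ _ res res_scale.

Lemma res_eq0 p : res p = 0 <-> exists q, p = q * g.
Proof.
rewrite -(rmorph0 res); split=> [/eqP|pg].
  by rewrite -Quotient.idealrBE subr0 => /asboolP.
by apply/eqP; rewrite -Quotient.idealrBE subr0; apply/asboolP.
Qed.

Lemma res_onto f : exists p, f = res p.
Proof. by exists (repr f); rewrite /residue reprK. Qed.

Definition other_blocks i : {mpoly K[n]} :=
  \sum_(i' | i' != i) 'X_[block_mon t i'].

Lemma trinomial_poly_other_blocks i : g = 'X_[block_mon t i] + other_blocks i.
Proof. rewrite trinomial_polyE; exact: bigD1. Qed.

Lemma res_block_mon i : res 'X_[block_mon t i] = res (- other_blocks i).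
Proof.
apply/eqP; rewrite -subr_eq0 -raddfB opprK -trinomial_poly_other_blocks.
apply/eqP.
by apply/res_eq0; exists 1; rewrite mul1r.
Qed.

Lemma block_monE i s : block_mon t i s = if block s == i then weight s else 0%N.
Proof. exact: mnmE. Qed.

Lemma block_mon_inj : injective (block_mon t).
Proof.
move=> i i'; have [s <-] := block_onto t i => /mnmP/(_ s).
by rewrite !block_monE eqxx; case: eqP => // _; have := weight_gt0 s; lia.
Qed.

Lemma other_blocks_neq0 i : other_blocks i != 0.
Proof.
have nei : lift i ord0 != i by rewrite eq_sym neq_lift.
have coef1 : (other_blocks i)@_(block_mon t (lift i ord0)) = 1.
  rewrite linear_sum /=; rewrite [LHS](bigD1 (lift i ord0)) //=.
  rewrite mcoeffX eqxx -[RHS]addr0; congr (_ + _).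
  apply: big1 => i' /andP[_ ne].
  by rewrite mcoeffX (inj_eq block_mon_inj) (negPf ne).
apply: contra_eqN coef1 => /eqP ->.
by rewrite mcoeff0 eq_sym oner_neq0.
Qed.

Lemma free_of_other_blocks s : free_of s (other_blocks (block s)).
Proof.
apply: free_of_sum => i _ nei; apply: free_ofX.
by rewrite block_monE eq_sym (negPf nei).
Qed.

Lemma free_of_res_eq0 s p : free_of s p -> res p = 0 -> p = 0.
Proof.
move=> fp /res_eq0[q].
set m := [multinom if s' == s then 0%N else block_mon t (block s) s' | s' < n].
rewrite (trinomial_poly_other_blocks (block s)).
have -> : block_mon t (block s) = (U_(s) *+ weight s + m)%MM.
  apply/mnmP => s'; rewrite mnmDE mulmnE mnm1E /m mnmE block_monE.
  by have [->|_] := eqVneq s s'; rewrite ?eqxx ?mul1n ?addn0.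
rewrite mpolyXD -mpolyXn => pE.
apply: free_of_multiple fp pE; last exact: free_of_other_blocks.
- exact: weight_gt0.
- by rewrite -msupp_eq0 msuppX.
- by apply: free_ofX; rewrite mnmE eqxx.
Qed.

(** Completing [m] to a power of the block monomial and replacing the latter by
    the opposite of the sum of the other two turns the hypothesis into one on a
    polynomial free of ['X_s], which must then be zero. *)
Lemma block_monomial_res_neq0 s (m : 'X_{1..n}) p :
  (forall s', block s' != block s -> m s' = 0%N) -> free_of s p ->
  res ('X_[m] * p) = 0 -> p = 0.
Proof.
move=> m0 fp mp0; set i := block s in m0.
have lem : (m <= block_mon t i *+ mdeg m)%MM.
  apply/mnm_lepP => s'; rewrite mulmnE block_monE.
  have [_|/m0 -> //] := eqVneq (block s') i.
  apply: (@leq_trans (mdeg m)); last by rewrite leq_pmull ?weight_gt0.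
  by rewrite mdegE (bigD1 s') //= leq_addr.
have : res ((- other_blocks i) ^+ mdeg m * p) = 0.
  rewrite rmorphM rmorphXn /= -res_block_mon -rmorphXn mpolyXn -rmorphM /=.
  by rewrite -(submK lem) mpolyXD -mulrA [LHS]rmorphM /= mp0 mulr0.
have fo : free_of s ((- other_blocks i) ^+ mdeg m * p).
  by apply: free_ofM fp; apply/free_ofXn/free_ofN/free_of_other_blocks.
move/(free_of_res_eq0 fo)/eqP; rewrite mulf_eq0 expf_eq0 oppr_eq0.
by rewrite (negPf (other_blocks_neq0 i)) andbF => /eqP.
Qed.

End Quotient.

(** * The grading, and homogeneous elements as non-zero-divisors *)

Section Grading.
Variables (t : trinomial) (K : fieldType).
Local Notation n := (\sum_i nvars t i)%N.
Local Notation R := (trinomial_algebra t K).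
Local Notation g := (trinomial_poly t K).
Local Notation res := (@residue t K).
Implicit Types (p q : {mpoly K[n]}) (w : grading_group t) (f h : R).

(** The step of the rigidity argument that uses the grading: with [a] a monomial
    of [d 'X_s] and [a'] one of [d 'X_s'], the equality of degrees is that of the
    two terms of [d ('X_s * 'X_s')]. *)
Lemma block_mon_cofactor_le (a a' : 'X_{1..n}) s s' :
  block s != block s' -> a s = 0%N ->
  degm (a + U_(s')) = degm (a' + U_(s)) :> grading_group t ->
  (block_mon t (block s) - U_(s) <= a')%MM.
Proof.
move=> neb as0 /eq_degm[c _ cE]; set p := block s in neb *.
apply/mnm_lepP => r; rewrite mnmBE block_monE mnm1E.
have [br|_ //] := eqVneq (block r) p.
have ne_s' r' : block r' = p -> (s' == r') = false.
  by move=> br'; apply: contra_neqF neb => /eqP ->.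
have := cE s; rewrite !mnmDE !mnm1E eqxx (ne_s' s erefl) as0 -/p.
have := cE r; rewrite !mnmDE !mnm1E (ne_s' r br) br.
have := weight_gt0 s; have := weight_gt0 r.
move=> wr ws Er Es.
(* The entry of [a] at [s] vanishes, so the shift in the block of [s] is
   strictly negative: at least one whole block monomial passes to [a']. *)
have c_neg : (c p <= -1)%R by nia.
have c_wr : (c p * weight r <= - (weight r)%:Z)%R by nia.
by move: Er; case: eqVneq => _ /= Er; lia.
Qed.

Lemma poly_component0 w : poly_component w (0 : {mpoly K[n]}).
Proof. by move=> m; rewrite msupp0. Qed.

Lemma poly_componentX (m : 'X_{1..n}) :
  poly_component (degm m) ('X_[m] : {mpoly K[n]}).
Proof. by move=> m'; rewrite msuppX inE => /eqP ->. Qed.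

Lemma poly_componentD w p q :
  poly_component w p -> poly_component w q -> poly_component w (p + q).
Proof.
by move=> pw qw m /msuppD_le; rewrite mem_cat => /orP[/pw|/qw].
Qed.

Lemma poly_componentZ w c p : poly_component w p -> poly_component w (c *: p).
Proof. by move=> pw m mp; apply: pw; apply: msuppZ_le mp. Qed.

Lemma poly_component_sum w (I : Type) (r : seq I) (P : pred I) F :
  (forall i, P i -> poly_component w (F i : {mpoly K[n]})) ->
  poly_component w (\sum_(i <- r | P i) F i).
Proof.
move=> Fw; apply: (big_ind (@poly_component t K w)) => //.
  exact: poly_component0.
exact: poly_componentD.
Qed.

Lemma poly_componentM w1 w2 p q : poly_component w1 p -> poly_component w2 q ->
  poly_component (w1 + w2) (p * q).
Proof.
move=> pw qw m /msuppM_le /allpairsP[[m1 m2]] /= [m1p m2q ->].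
by rewrite degmD (pw _ m1p) (qw _ m2q).
Qed.

(** This is the homogeneity of the trinomial. *)
Lemma degm_block_mon i i' :
  degm (block_mon t i) = degm (block_mon t i') :> grading_group t.
Proof.
have sum1 j : \sum_(k < 3) (k == j)%:Z = 1.
  by rewrite (bigD1 j) //= eqxx big1 // => k /negPf ->.
apply/eq_degm; exists (fun j => (j == i)%:Z - (j == i')%:Z) => [|s].
  by rewrite sumrB !sum1 subrr.
by rewrite !block_monE; case: eqP; case: eqP => _ _; lia.
Qed.

Lemma poly_component_trinomial i : poly_component (degm (block_mon t i)) g.
Proof.
rewrite trinomial_polyE; apply: poly_component_sum => i' _.
by rewrite (degm_block_mon i i'); apply: poly_componentX.
Qed.

Lemma componentX (m : 'X_{1..n}) : component (degm m) (res 'X_[m]).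
Proof. by exists 'X_[m] => //; apply: poly_componentX. Qed.

Definition graded_proj w p := \sum_(m <- msupp p | degm m == w) p@_m *: 'X_[m].

Lemma mcoeff_graded_proj w p m :
  (graded_proj w p)@_m = if degm m == w then p@_m else 0.
Proof.
rewrite linear_sum /=.
under eq_bigr => m' _ do rewrite mcoeffZ mcoeffX.
have [mp|mp] := boolP (m \in msupp p); last first.
  rewrite (memN_msupp_eq0 mp) if_same big_seq_cond big1 // => m' /andP[m'p _].
  by have [m'm|] := eqVneq m' m; rewrite ?mulr0 // -m'm m'p in mp *.
rewrite big_mkcond (bigD1_seq m) ?msupp_uniq //= eqxx mulr1.
rewrite -[RHS]addr0; congr (_ + _); apply: big1 => m' ne.
by rewrite (negPf ne) mulr0 if_same.
Qed.

Lemma graded_projD w p q : graded_proj w (p + q) = graded_proj w p + graded_proj w q.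
Proof.
apply/mpolyP => m; rewrite mcoeffD !mcoeff_graded_proj mcoeffD.
by case: ifP; rewrite ?addr0.
Qed.

Lemma graded_projN w p : graded_proj w (- p) = - graded_proj w p.
Proof.
apply/mpolyP => m; rewrite mcoeffN !mcoeff_graded_proj mcoeffN.
by case: ifP; rewrite ?oppr0.
Qed.

Lemma graded_proj_component w p : poly_component w p -> graded_proj w p = p.
Proof.
move=> pw; apply/mpolyP => m; rewrite mcoeff_graded_proj; case: eqP => // ne.
by rewrite memN_msupp_eq0 //; apply/negP => /pw.
Qed.

Lemma graded_proj_other_component w w' p : w != w' ->
  poly_component w p -> graded_proj w' p = 0.
Proof.
move=> ne pw; apply/mpolyP => m; rewrite mcoeff_graded_proj mcoeff0.
case: eqP => // mw'.
by rewrite memN_msupp_eq0 //; apply: contra ne => /pw <-; rewrite mw'.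
Qed.

(** The ideal is generated by a homogeneous element, hence contains the
    homogeneous parts of its elements. *)
Lemma res_graded_proj w p : res p = 0 -> res (graded_proj w p) = 0.
Proof.
move=> /res_eq0[q ->]; elim/mpolyind: q => [|c m q _ _ IHq].
  by rewrite mul0r (graded_proj_component (@poly_component0 w)) rmorph0.
rewrite mulrDl graded_projD [LHS]rmorphD /= IHq addr0.
have hom : poly_component (degm m + degm (block_mon t ord0)) (c *: 'X_[m] * g).
  apply: poly_componentM (poly_component_trinomial _).
  exact/poly_componentZ/poly_componentX.
have [ew|ne] := eqVneq (degm m + degm (block_mon t ord0)) w; last first.
  by rewrite (graded_proj_other_component ne hom) rmorph0.
rewrite ew in hom; rewrite (graded_proj_component hom).
by apply/res_eq0; exists (c *: 'X_[m]).
Qed.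

(** The components of the quotient are independent, so a homogeneous sum of two
    nonzero homogeneous elements forces their degrees to agree. *)
Lemma component_homogeneousD w w' f h : component w f -> component w' h ->
  f != 0 -> h != 0 -> homogeneous (f + h) -> w = w'.
Proof.
move=> [p pw fE] [q qw' hE] f0 h0 [w'' [r rw'' fhE]].
apply/eqP; apply: contraT => ne.
have pqr : res (p + q - r) = 0.
  rewrite raddfB raddfD /=; apply/eqP; rewrite subr_eq0; apply/eqP.
  by rewrite -[RHS]fhE fE hE.
have [ew|ne''] := eqVneq w'' w.
  move: (res_graded_proj w' pqr); rewrite !graded_projD graded_projN.
  rewrite (graded_proj_other_component ne pw).
  rewrite (graded_proj_component qw') (graded_proj_other_component _ rw'') ?ew //.
  rewrite add0r subr0 => q0; move: h0.
  by rewrite hE -[X in X != 0]/(res q) q0 eqxx.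
move: (res_graded_proj w pqr); rewrite !graded_projD graded_projN.
rewrite (graded_proj_component pw).
rewrite eq_sym in ne.
rewrite (graded_proj_other_component ne qw').
rewrite (graded_proj_other_component ne'' rw'').
rewrite addr0 subr0 => p0; move: f0.
by rewrite fE -[X in X != 0]/(res p) p0 eqxx.
Qed.

Lemma poly_component_divX w (e : 'X_{1..n}) p : poly_component w p ->
  {in msupp p, forall m, (e <= m)%MM} ->
  exists2 q, poly_component (w - degm e) q & p = 'X_[e] * q.
Proof.
move=> pw pe; exists (\sum_(m <- msupp p) p@_m *: 'X_[m - e]); last first.
  rewrite [LHS]mpolyE mulr_sumr [LHS]big_seq [RHS]big_seq; apply: eq_bigr => m mp.
  by rewrite -scalerAr -mpolyXD addmC submK // pe.
rewrite [X in poly_component _ X]big_seq.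
apply: poly_component_sum => m mp; apply: poly_componentZ.
rewrite -(pw m mp) -[in degm m](submK (pe m mp)) degmD addrK.
exact: poly_componentX.
Qed.

(** Among the monomials of a homogeneous [p] choose one, [m1], of least exponent
    in ['X_s].  In the block of [s] the others differ from it by powers of the
    block monomial, with nonnegative exponents by the choice of [m1], and these
    powers can be rewritten with the other two blocks. *)
Lemma component_normal_form s w f : component w f ->
  exists (m : 'X_{1..n}) p,
    [/\ forall s', block s' != block s -> m s' = 0%N, free_of s p &
        f = res ('X_[m] * p)].
Proof.
move=> [p pw ->]; have [->|p0] := eqVneq p 0.
  exists 0%MM, 0; split => [s' _||]; last by rewrite mulr0.
    by rewrite mnm0E.
  by rewrite /free_of !rmorph0.
have [m1 m1p m1min] : exists2 m1, m1 \in msupp p &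
    {in msupp p, forall m : 'X_{1..n}, m1 s <= m s}%N.
  have ex : exists k, has (fun m : 'X_{1..n} => m s == k) (msupp p).
    move: p0; rewrite -msupp_eq0; case: (msupp p) => // m r _.
    by exists (m s); rewrite /= eqxx.
  case: (ex_minnP ex) => k /hasP[m1 m1p /eqP <-] kmin; exists m1 => // m mp.
  by apply: kmin; apply/hasP; exists m.
pose k (m : 'X_{1..n}) := ((m s - m1 s) %/ weight s)%N.
pose m0 := [multinom if block s' == block s then m1 s' else 0%N | s' < n].
pose off (m : 'X_{1..n}) :=
  [multinom if block s' == block s then 0%N else m s' | s' < n].
have mE m : m \in msupp p -> m = (m0 + (block_mon t (block s) *+ k m + off m))%MM.
  move=> mp; have := pw m mp; rewrite -(pw _ m1p) => /eq_degm[c _ cE].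
  have ck : c (block s) = k m.
    have E := cE s.
    have c_ge0 : (0 <= c (block s))%R.
      by have := weight_gt0 s; have := m1min m mp; nia.
    move: c_ge0 E; case: (c (block s)) => // a _ E.
    have ms : m s = (m1 s + a * weight s)%N by lia.
    by rewrite /k ms addKn mulnK // weight_gt0.
  apply/mnmP => s'; rewrite !mnmDE mulmnE block_monE !mnmE.
  have [es'|//] := eqVneq (block s') (block s).
  by have := cE s'; rewrite es' ck; lia.
pose q m := (- other_blocks t K (block s)) ^+ k m * 'X_[off m].
exists m0, (\sum_(m <- msupp p) p@_m *: q m); split.
- by move=> s' /negPf ne; rewrite mnmE ne.
- apply: free_of_sum => m _ _; apply/free_ofZ/free_ofM; last first.
    by apply: free_ofX; rewrite mnmE eqxx.
  exact/free_ofXn/free_ofN/free_of_other_blocks.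
rewrite -[LHS]/(res p) [in LHS](mpolyE p) mulr_sumr !raddf_sum.
rewrite [LHS]big_seq [RHS]big_seq; apply: eq_bigr => m mp /=.
rewrite -scalerAr !linearZ /=; congr (_ *: _).
rewrite [in LHS](mE m mp) !mpolyXD -mpolyXn !rmorphM /= !rmorphXn /=.
by rewrite res_block_mon.
Qed.

(** Normal forms multiply: the product of two of them is again a monomial of the
    block times a polynomial free of the variable. *)
Lemma homogeneous_mulf_eq0 f h : homogeneous f -> homogeneous h ->
  f * h = 0 -> f = 0 \/ h = 0.
Proof.
have [s _] := block_onto t ord0.
move=> [w fw] [w' hw'].
have [m [p [m0 fp ->]]] := component_normal_form s fw.
have [m' [p' [m'0 fp' ->]]] := component_normal_form s hw'.
rewrite -rmorphM mulrACA -mpolyXD => /(block_monomial_res_neq0 (s := s)) pp'0.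
have /eqP : p * p' = 0.
  apply: pp'0; last exact: free_ofM.
  by move=> s' ne; rewrite mnmDE m0 ?m'0.
by rewrite mulf_eq0 => /orP[]/eqP ->; [left|right]; rewrite mulr0 rmorph0.
Qed.

Lemma res_X_neq0 (m : 'X_{1..n}) : res 'X_[m] != 0.
Proof.
have [s s0] := block_onto t ord0.
pose m0 := [multinom if block s' == block s then m s' else 0%N | s' < n].
pose m' := [multinom if block s' == block s then 0%N else m s' | s' < n].
have -> : m = (m0 + m')%MM.
  by apply/mnmP => s'; rewrite mnmDE !mnmE; case: eqP; rewrite ?addn0.
rewrite mpolyXD; apply/eqP => /(block_monomial_res_neq0 (s := s)) H.
have : 'X_[m'] = 0 :> {mpoly K[n]}.
  apply: H; last by apply: free_ofX; rewrite mnmE eqxx.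
  by move=> s' /negPf ne; rewrite mnmE ne.
by move/eqP; rewrite -msupp_eq0 msuppX.
Qed.

End Grading.

(** * Rigidity when every exponent is at least two *)

Section Rigidity.
Variables (K : fieldType) (charK : [pchar K] =i pred0) (t : trinomial).
Local Notation n := (\sum_i nvars t i)%N.
Local Notation R := (trinomial_algebra t K).
Local Notation res := (@residue t K).
Variable d : {linear R -> R}.
Hypotheses (der : derivation d) (lnd : locally_nilpotent d).
Hypothesis hom : deg_homogeneous d.
Local Notation nu := (nu lnd).
Implicit Types (f h : R) (p q : {mpoly K[n]}) (m : 'X_{1..n}).

Lemma homogeneous_iter k f : homogeneous f -> homogeneous (iter k d f).
Proof. by move=> fh; elim: k => //= k; apply: hom. Qed.

(** In Leibniz' formula at the exponent [nu f + nu h] a single term survives, a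
    binomial coefficient times a product of nonzero homogeneous elements. *)
Lemma nuM f h : homogeneous f -> homogeneous h -> f != 0 -> h != 0 ->
  nu (f * h) = (nu f + nu h)%N.
Proof.
move=> fh hh f0 h0; set a := nu f; set b := nu h.
apply: nu_eq; rewrite derivation_iterM //; last first.
  apply: big1 => i _; have [lt|ge] := ltnP b i.
    by rewrite (iter_gt_nu lt) mulr0 mul0rn.
  by rewrite (iter_gt_nu (k := _ - i)) ?mul0r ?mul0rn // -/a; lia.
have ltb : (b < (a + b).+1)%N by rewrite ltnS leq_addl.
rewrite (bigD1 (Ordinal ltb)) //= addnK big1 ?addr0; last first.
  move=> [i ?] /=; rewrite -val_eqE /= => ne; have [lt|ge] := ltnP b i.
    by rewrite (iter_gt_nu lt) mulr0 mul0rn.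
  by rewrite (iter_gt_nu (k := _ - i)) ?mul0r ?mul0rn // -/a; lia.
rewrite -scaler_nat scaler_eq0 ((pcharf0P K).1 charK) negb_or.
rewrite -lt0n bin_gt0 leq_addl /=.
apply/eqP => /homogeneous_mulf_eq0[||/eqP|/eqP].
- exact: homogeneous_iter.
- exact: homogeneous_iter.
- by rewrite (negPf (iter_nu lnd f0)).
- by rewrite (negPf (iter_nu lnd h0)).
Qed.

Lemma homogeneousX m : homogeneous (res 'X_[m]).
Proof. by eexists; apply: componentX. Qed.

Lemma nuXD m1 m2 :
  nu (res 'X_[m1 + m2]) = (nu (res 'X_[m1]) + nu (res 'X_[m2]))%N.
Proof.
rewrite mpolyXD rmorphM; apply: nuM; do ?exact: homogeneousX; exact: res_X_neq0.
Qed.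

Lemma nuX0 : nu (res 'X_[0]) = 0%N.
Proof. by have := nuXD 0 0; rewrite addm0; lia. Qed.

Lemma nuXE m : nu (res 'X_[m]) = (\sum_s nu (res 'X_s) * m s)%N.
Proof.
rewrite [in LHS](multinomUE_id m).
rewrite (big_morph (fun m => nu (res 'X_[m])) nuXD nuX0); apply: eq_bigr => s _.
elim: (m s) => [|k IHk]; first by rewrite [RHS]muln0; exact: nuX0.
by rewrite mulmS nuXD IHk mulnS.
Qed.

Lemma derivation_eq0 : (forall s, nu (res 'X_s) = 0%N) -> forall f, d f = 0.
Proof.
move=> nu0 f; have [p ->] := res_onto f.
rewrite (mpolyE p) !linear_sum big1 // => m _.
rewrite !linearZ /= (nu_eq0 (lnd := lnd)) ?scaler0 //.
by rewrite nuXE big1 // => s _; rewrite nu0.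
Qed.

(** The two terms of [d ('X_s * 'X_s')] are nonzero and homogeneous, and so is
    their sum; hence they have the same degree. *)
Lemma component_deriv_X s s' (P P' : {mpoly K[n]}) w w' :
  d (res 'X_s) = res P -> d (res 'X_s') = res P' ->
  poly_component w P -> poly_component w' P' ->
  res P != 0 -> res P' != 0 -> w + degv s' = w' + degv s.
Proof.
move=> dP dP' Pw P'w P0 P'0.
apply: (@component_homogeneousD t K _ _ (res (P * 'X_s')) (res ('X_s * P'))).
- exists (P * 'X_s') => //; rewrite -degm1.
  by apply: poly_componentM Pw _; apply: poly_componentX.
- exists ('X_s * P') => //; rewrite addrC -degm1.
  by apply: poly_componentM P'w; apply: poly_componentX.
- rewrite rmorphM; apply/eqP => /homogeneous_mulf_eq0[||/eqP|/eqP].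
  + by exists w, P.
  + exact: homogeneousX.
  + by rewrite (negPf P0).
  + by rewrite (negPf (res_X_neq0 _ _)).
- rewrite rmorphM; apply/eqP => /homogeneous_mulf_eq0[||/eqP|/eqP].
  + exact: homogeneousX.
  + by exists w', P'.
  + by rewrite (negPf (res_X_neq0 _ _)).
  + by rewrite (negPf P'0).
rewrite !rmorphM /= -dP -dP' -der -rmorphM -mpolyXD.
exact/hom/homogeneousX.
Qed.

Lemma nu_divX (e : 'X_{1..n}) w p : poly_component w p -> res p != 0 ->
  {in msupp p, forall m, (e <= m)%MM} -> (nu (res 'X_[e]) <= nu (res p))%N.
Proof.
move=> pw p0 /(poly_component_divX pw)[q qw pE].
move: p0; rewrite pE rmorphM => p0; rewrite nuM ?leq_addr //.
- exact: homogeneousX.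
- by exists (w - degm e), q.
- exact: res_X_neq0.
- by apply: contraNneq p0 => /= ->; rewrite mulr0.
Qed.

(** Below, [p] and [q] are blocks where the order of the block monomial is
    largest, and [s] and [s'] are variables of these blocks of positive order. *)
Lemma no_derivation : (forall s : 'I_n, 1 < weight s)%N -> forall f, d f = 0.
Proof.
move=> wt2; apply: derivation_eq0.
have y0 i : res 'X_[block_mon t i] != 0 by exact: res_X_neq0.
have ysum : \sum_i res 'X_[block_mon t i] = 0.
  rewrite -raddf_sum -trinomial_polyE; apply/res_eq0.
  by exists 1; rewrite mul1r.
have [p [q [neq nupq maxp]]] := max_nu_sum0 lnd ord0 y0 ysum.
pose x s := nu (res 'X_s).
have le2 s : (2 * x s <= nu (res 'X_[block_mon t p]))%N.
  apply: leq_trans (maxp (block s)); rewrite nuXE (bigD1 s) //= block_monE eqxx.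
  by apply: leq_trans (leq_addr _ _); rewrite mulnC leq_mul2l wt2 orbT.
have pos i : (0 < nu (res 'X_[block_mon t i]))%N ->
    exists2 s, block s = i & (0 < x s)%N.
  rewrite nuXE => gt0; have [/existsP[s /andP[/eqP bs xs]]|none] :=
    boolP [exists s, (block s == i) && (0 < x s)%N]; first by exists s.
  move: gt0; rewrite big1 // => s _; rewrite block_monE.
  case: eqP => [bs|]; rewrite ?muln0 //.
  move: none; rewrite negb_exists => /forallP/(_ s).
  by rewrite bs eqxx /= -eqn0Ngt => /eqP xs0; rewrite -/(x s) xs0.
have [/eqP N0 s|N0] := posnP (nu (res 'X_[block_mon t p])).
  by have := le2 s; rewrite (eqP N0) /x; lia.
have [s bs xs] := pos p N0.
have [s' bs' xs'] : exists2 s, block s = q & (0 < x s)%N.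
  by apply: pos; rewrite -nupq.
have dX_neq0 r : (0 < x r)%N -> d (res 'X_r) != 0.
  move=> xr; apply/eqP => dr; have := iter_nu lnd (res_X_neq0 K U_(r)).
  by rewrite -/(x r); case: (x r) xr => // k _; rewrite iterSr dr iter0 eqxx.
have dX_hom r : homogeneous (d (res 'X_r)) by apply/hom/homogeneousX.
have [w [P Pw dP]] := dX_hom s; have [w' [P' P'w dP']] := dX_hom s'.
have P0 : res P != 0 by rewrite -[res P]dP dX_neq0.
have P'0 : res P' != 0 by rewrite -[res P']dP' dX_neq0.
have ww' := component_deriv_X dP dP' Pw P'w P0 P'0.
have nuP' : x s' = (nu (res P')).+1 by rewrite -[res P']dP' -nu_deriv // dX_neq0.
(* If 'X_s occurred in every monomial of P, it would divide d 'X_s, whose order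
   is smaller. *)
have [a aP as0] : exists2 a : 'X_{1..n}, a \in msupp P & a s = 0%N.
  have [/hasP[a aP /eqP as0]|none] :=
    boolP (has (fun a : 'X_{1..n} => a s == 0%N) (msupp P)).
    by exists a.
  have := nu_divX (e := U_(s)%MM) Pw P0.
  rewrite -/(x s) -[res P]dP [x s]nu_deriv ?dX_neq0 // ltnn => bad.
  suff: false by []; apply: bad => m mP.
  apply/mnm_lepP => r; rewrite mnm1E; have [<-|//] := eqVneq s r.
  by rewrite lt0n; apply: contra none => ms; apply/hasP; exists m.
(* It remains to compare the order of d 'X_s' with that of y_p / 'X_s. *)
have := nu_divX (e := (block_mon t p - U_(s))%MM) P'w P'0.
have sp : (U_(s) <= block_mon t p)%MM.
  apply/mnm_lepP => r; rewrite mnm1E; have [<-|//] := eqVneq s r.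
  by rewrite block_monE bs eqxx weight_gt0.
have := nuXD (block_mon t p - U_(s)) U_(s); rewrite submK // -/(x s).
have := le2 s; have := le2 s'.
suff le : {in msupp P', forall m, (block_mon t p - U_(s) <= m)%MM}.
  by move=> ? ? ? /(_ le); lia.
move=> a' a'P'; rewrite -bs; apply: (@block_mon_cofactor_le t a _ s s') => //.
  by rewrite bs bs'.
by rewrite !degmD !degm1 (Pw _ aP) (P'w _ a'P').
Qed.

End Rigidity.

(** * The derivation attached to a variable of exponent one *)

Section Elementary.
Variables (K : fieldType) (t : trinomial).
Local Notation n := (\sum_i nvars t i)%N.
Local Notation R := (trinomial_algebra t K).
Local Notation res := (@residue t K).
Local Notation g := (trinomial_poly t K).
Variables s0 s1 : 'I_n.
Hypotheses (neb : block s0 != block s1) (w1 : weight s0 = 1%N).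
Implicit Types (p q : {mpoly K[n]}) (w : grading_group t) (m : 'X_{1..n}).

(** The monomial [y_i / 'X_s0], for [i] the block of [s0]; it is the partial
    derivative of [g] in the variable of exponent one. *)
Definition cofactor_poly : {mpoly K[n]} := 'X_[block_mon t (block s0) - U_(s0)].
Definition partial_poly : {mpoly K[n]} := ('X_[block_mon t (block s1)])^`M(s1).

(** The Jacobian derivation of [g] with respect to the two variables. *)
Definition elementary_poly p :=
  cofactor_poly * p^`M(s1) - partial_poly * p^`M(s0).

Fact elementary_poly_linear : linear elementary_poly.
Proof.
move=> c p q; rewrite /elementary_poly !linearP /= !mulrDr -!scalerAr opprD scalerBr.
by rewrite addrACA.
Qed.
HB.instance Definition _ :=
  GRing.isLinear.Build _ _ _ _ elementary_poly elementary_poly_linear.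

Lemma elementary_polyM p q :
  elementary_poly (p * q) = elementary_poly p * q + p * elementary_poly q.
Proof. by rewrite /elementary_poly !mderivM; ring. Qed.

Lemma mderiv_trinomial s : g^`M(s) = ('X_[block_mon t (block s)])^`M(s).
Proof.
rewrite (trinomial_poly_other_blocks _ _ (block s)) mderivD -[RHS]addr0.
congr (_ + _).
rewrite linear_sum; apply: big1 => i ne /=.
by rewrite mderivX block_monE eq_sym (negPf ne) scale0r.
Qed.

Lemma elementary_poly_trinomial : elementary_poly g = 0.
Proof.
have dM : ('X_[block_mon t (block s0)])^`M(s0) = cofactor_poly.
  by rewrite mderivX block_monE eqxx w1 scale1r.
by rewrite /elementary_poly !mderiv_trinomial dM mulrC subrr.
Qed.

(** As [elementary_poly] is a derivation that kills [g], it preserves the ideal;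
    the choice of a representative does not matter. *)
Definition elementary_fun (f : R) : R := res (elementary_poly (repr f)).

Lemma elementary_fun_res p : elementary_fun (res p) = res (elementary_poly p).
Proof.
apply/eqP; rewrite -subr_eq0 -raddfB -linearB /=; apply/eqP.
have /res_eq0[q ->] : res (repr (res p) - p) = 0.
  by rewrite raddfB /= /residue reprK subrr.
apply/res_eq0; exists (elementary_poly q).
by rewrite elementary_polyM elementary_poly_trinomial mulr0 addr0.
Qed.

Fact elementary_fun_linear : linear elementary_fun.
Proof.
move=> c f h; have [p ->] := res_onto f; have [q ->] := res_onto h.
by rewrite -linearP !elementary_fun_res !linearP.
Qed.
HB.instance Definition _ :=
  GRing.isLinear.Build _ _ _ _ elementary_fun elementary_fun_linear.

Definition elementary : {linear R -> R} := elementary_fun.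

Lemma elementary_res p : elementary (res p) = res (elementary_poly p).
Proof. exact: elementary_fun_res. Qed.

Lemma derivation_elementary : derivation elementary.
Proof.
move=> f h; have [p ->] := res_onto f; have [q ->] := res_onto h.
by rewrite -rmorphM !elementary_res elementary_polyM rmorphD !rmorphM.
Qed.

Lemma poly_component_mderiv w s p :
  poly_component w p -> poly_component (w - degv s) p^`M(s).
Proof.
move=> pw m; rewrite mcoeff_msupp mcoeff_mderiv => nz.
have /pw <- : (m + U_(s))%MM \in msupp p.
  by rewrite mcoeff_msupp; apply: contraNneq nz => ->; rewrite mul0rn.
by rewrite degmD degm1 addrK.
Qed.

Lemma deg_homogeneous_elementary : deg_homogeneous elementary.
Proof.
move=> _ [w [p pw ->]].
exists (degm (block_mon t (block s0)) - degv s0 + (w - degv s1)).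
exists (elementary_poly p); last exact: elementary_res.
have Msub : (U_(s0) <= block_mon t (block s0))%MM.
  apply/mnm_lepP => r; rewrite mnm1E; have [<-|//] := eqVneq s0 r.
  by rewrite block_monE eqxx weight_gt0.
apply: poly_componentD.
  apply: poly_componentM (poly_component_mderiv pw).
  rewrite -degm1 -[in X in X - _](submK Msub) degmD addrK; exact: poly_componentX.
rewrite -scaleN1r; apply: poly_componentZ.
rewrite addrACA [X in _ + X]addrC addrACA (degm_block_mon _ _ (block s1)).
apply: poly_componentM (poly_component_mderiv pw).
exact/poly_component_mderiv/poly_componentX.
Qed.

Lemma mderiv_X0 m s : m s = 0%N -> ('X_[m] : {mpoly K[n]})^`M(s) = 0.
Proof. by move=> ms; rewrite mderivX ms scale0r. Qed.

Lemma elementary_polyX0 m :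
  m s0 = 0%N -> m s1 = 0%N -> elementary_poly 'X_[m] = 0.
Proof. by move=> m0 m1; rewrite /elementary_poly !mderiv_X0 // !mulr0 subrr. Qed.

Lemma elementary_Xs1 : elementary (res 'X_s1) = res cofactor_poly.
Proof.
have ne : s1 != s0 by apply: contraNneq neb => ->.
rewrite elementary_res /elementary_poly mderivX mderiv_X0 mnm1E ?(negPf ne) //.
rewrite eqxx scale1r.
have -> : (U_(s1) - U_(s1) = 0)%MM by apply/mnmP => s; rewrite mnmBE subnn mnm0E.
by rewrite mpolyX0 mulr1 mulr0 subr0.
Qed.

Lemma nilpotent_X m :
  (forall s, (0 < m s)%N -> nilpotent_at elementary (res 'X_s)) ->
  nilpotent_at elementary (res 'X_[m]).
Proof.
move=> nil; rewrite mpolyXE_id rmorph_prod.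
apply: (big_ind (nilpotent_at elementary)) => [||s _].
- exact: nilpotent_at1 derivation_elementary.
- exact: nilpotent_atM derivation_elementary.
rewrite rmorphXn /=; case: (posnP (m s)) => [->|/nil nils].
  exact: nilpotent_at1 derivation_elementary.
by apply: nilpotent_atXn nils; apply: derivation_elementary.
Qed.

(** The derivation is triangular: ['X_s1] goes to a monomial in the kernel, and
    ['X_s0] to a polynomial in the other variables. *)
Lemma locally_nilpotent_elementary : locally_nilpotent elementary.
Proof.
have nilX s : s != s0 -> nilpotent_at elementary (res 'X_s).
  move=> ne0; have [->|ne1] := eqVneq s s1.
    apply: nilpotent_at_deriv; rewrite [X in nilpotent_at _ X]elementary_Xs1.
    exists 1%N; rewrite /= elementary_res.
    rewrite elementary_polyX0 ?rmorph0 // mnmBE block_monE mnm1E.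
      by rewrite !eqxx w1.
    by rewrite [block s1 == _]eq_sym (negPf neb).
  exists 1%N; rewrite /= elementary_res elementary_polyX0 ?rmorph0 // mnm1E.
    by rewrite (negPf ne0).
  by rewrite (negPf ne1).
have nilX0 : nilpotent_at elementary (res 'X_s0).
  apply: nilpotent_at_deriv; rewrite /= elementary_res /elementary_poly.
  rewrite mderiv_X0 ?mulr0 ?sub0r; last first.
    by rewrite mnm1E; apply/eqP; rewrite eqb0; apply: contraNneq neb => ->.
  rewrite mderivX mnm1E eqxx scale1r.
  have -> : (U_(s0) - U_(s0) = 0)%MM by apply/mnmP => s; rewrite mnmBE subnn mnm0E.
  rewrite mpolyX0 mulr1 /partial_poly mderivX -scalerN -scaleN1r !linearZ /=.
  do 2 apply: nilpotent_atZ; apply: nilpotent_X => s ms; apply: nilX.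
  apply: contraTneq ms => ->; rewrite mnmBE block_monE (negPf neb).
  by rewrite sub0n.
move=> f; have [p ->] := res_onto f.
have [k kp] : nilpotent_at elementary (res p); last first.
  by exists k.+1 => //; rewrite iterS kp linear0.
rewrite (mpolyE p) raddf_sum.
apply: (big_ind (nilpotent_at elementary)) => [||m _].
- by exists 0%N.
- exact: nilpotent_atD.
rewrite /= linearZ /=; apply/nilpotent_atZ/nilpotent_X => s _.
by have [->|/nilX] := eqVneq s s0.
Qed.

End Elementary.

Theorem corollary2 (K : closedFieldType) (charK : [pchar K] =i pred0)
    (t : trinomial) (t_nonlinear : nonlinear t) :
  (exists d : {linear trinomial_algebra t K -> trinomial_algebra t K},
     [/\ derivation d, locally_nilpotent d, deg_homogeneous d
       & exists f, d f != 0])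
  <-> exists (i : 'I_3) (j : 'I_(nvars t i)), expo t i j = 1%N.
Proof.
split=> [[d [der lnd hom [f df0]]]|[i [j eij]]].
  apply: contrapT => no1; move: df0.
  rewrite (no_derivation charK der lnd hom) ?eqxx // => s.
  have := weight_gt0 s; rewrite leq_eqVlt => /orP[/eqP ws|//].
  by case: no1; exists (block s), (tagnat.sig2 s).
pose s0 := tagnat.Rank i j; have [s1 bs1] := block_onto t (lift i ord0).
have neb : block s0 != block s1 by rewrite bs1 block_Rank neq_lift.
have w1 : weight s0 = 1%N by rewrite weight_Rank.
exists (elementary K s1 w1); split.
- exact: derivation_elementary.
- exact: locally_nilpotent_elementary.
- exact: deg_homogeneous_elementary.
exists (residue 'X_s1); rewrite [X in X != 0]elementary_Xs1 //; exact: res_X_neq0.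
Qed.
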